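(* Let $d\ge 2$ and let $D\subset\mathbb{R}^d$, $\emptyset\ne D\ne\mathbb{R}^d$, be an open simply connected set whose boundary $K=\partial D$ satisfies, for some $\alpha$ with $d-2<\alpha<d$ and some constants $C_1,C_2>0$, $$|K_\gamma\cap B(x,r)|\le C_1 r^\alpha\gamma^{d-\alpha}\qquad\text{for all } x\in\mathbb{R}^d \text{ and all } 1\ge r\ge\gamma>0,$$ $$|K_\gamma\cap B(x,r)|\ge C_2 r^\alpha\gamma^{d-\alpha}\qquad\text{for all } 1\ge r\ge\gamma>0 \text{ and all } x\in K_{r/2}.$$ Let $\beta>0$ and $V_\beta=d_K^{-\beta}$. Then the condition $\alpha+\beta\ge d$ is necessary for the Feynman-Kac semigroup with potential $V_\beta$ to separate $D$ and $D^c=\mathbb{R}^d\setminus D$ (i.e. for $p_t^{V_\beta}(x,y)=0$ for all $t>0$, $x\in D$, $y\in D^c$). Precisely, if $\alpha+\beta<d$, then $p_t^{V_\beta}(x,y)>0$ for all $t>0$ and all $x,y\in\mathbb{R}^d$.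
   Context: For a closed set $K\subset\mathbb{R}^d$: $d_K(x)=\inf\{|x-y|:y\in K\}$; for $\gamma>0$, $K_\gamma=\{x\in\mathbb{R}^d:d_K(x)\le\gamma\}$. $B(x,r)$ is the Euclidean ball and $|\cdot|$ is Lebesgue measure. Let $p_t(x,y)=(4\pi t)^{-d/2}e^{-|x-y|^2/(4t)}$. For $x,y\in\mathbb{R}^d$, $t>0$, let $\mu_{x,y}$ be the Brownian bridge measure on continuous paths $Y:[0,t]\to\mathbb{R}^d$ with $Y_0=x$, $Y_t=y$, for the Brownian motion with transition density $p_t$ (generator $\Delta=\sum_i\partial_i^2$), normalised to have total mass $p_t(x,y)$. For a potential $V\ge 0$ the kernel of the Feynman-Kac semigroup $T_tf(x)=\operatorname{E}_x\{e^{-\int_0^tV(X_s)ds}f(X_t)\}$ is $$p_t^V(x,y)=\int\exp\left(-\int_0^tV(Y_s)\,ds\right)d\mu_{x,y}(Y),\qquad \exp(-\infty)=0.$$ *)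

(* Defs.v *)
From HB Require Import structures.
From mathcomp Require Import all_boot all_order all_algebra.
From mathcomp Require Import all_classical all_reals all_analysis.
Import Order.TTheory GRing.Theory Num.Theory.
Import numFieldNormedType.Exports.

Set Implicit Arguments.
Unset Strict Implicit.
Unset Printing Implicit Defensive.

Local Open Scope classical_set_scope.
Local Open Scope ring_scope.

(** The sigma-algebra generated by the coordinates, as the library does for
    n.-tuple R; it coincides with the Borel sigma-algebra of R^n. *)
Section measurable_rV.
Context (R : realType) (n : nat).

Definition rV_coord (i : 'I_n) (x : 'rV[R]_n) : measurableTypeR R := x ord0 i.

Let rV_set0 : g_sigma_preimage rV_coord set0.
Proof. exact: sigma_algebra0. Qed.

Let rV_setC A : g_sigma_preimage rV_coord A -> g_sigma_preimage rV_coord (~` A).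
Proof. exact: sigma_algebraC. Qed.

Let rV_bigcup (F : _^nat) : (forall i, g_sigma_preimage rV_coord (F i)) ->
  g_sigma_preimage rV_coord (\bigcup_i (F i)).
Proof. exact: sigma_algebra_bigcup. Qed.

HB.instance Definition _ := @isMeasurable.Build default_measure_display
  'rV[R]_n (g_sigma_preimage rV_coord) rV_set0 rV_setC rV_bigcup.

Lemma measurable_rV_coord (i : 'I_n) : measurable_fun [set: 'rV[R]_n] (rV_coord i).
Proof.
move=> _ Y mY; rewrite setTI; apply: sub_sigma_algebra => /=.
rewrite -bigcup_seq/=; exists i => /=; first by rewrite mem_index_enum.
by exists Y => //; rewrite setTI.
Qed.

Lemma measurable_fun_rV d (T : measurableType d) (f : T -> 'rV[R]_n) :
  (forall i, measurable_fun [set: T] (rV_coord i \o f)) ->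
  measurable_fun [set: T] f.
Proof.
move=> mf.
have H : g_sigma_preimage (fun i => rV_coord i \o f) `<=` measurable.
  apply: smallest_sub; first exact: sigma_algebra_measurable.
  rewrite -bigcup_seq/=; apply: bigcup_sub => i _ A [B mB <-].
  by apply: mf.
move=> _ A mA; apply: H; rewrite g_sigma_preimage_comp.
by exists A.
Qed.

End measurable_rV.

Section lebesgue_rV.
Context (R : realType).
Local Open Scope ereal_scope.

Definition rV_cons n (p : measurableTypeR R * 'rV[R]_n) : 'rV[R]_n.+1 :=
  \row_i oapp (p.2 ord0) p.1 (unlift ord0 i).

Definition rV_uncons n (x : 'rV[R]_n.+1) : measurableTypeR R * 'rV[R]_n :=
  (x ord0 ord0, \row_i x ord0 (lift ord0 i)).

Lemma rV_consK n : cancel (@rV_cons n) (@rV_uncons n).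
Proof.
move=> [a v]; rewrite /rV_uncons /rV_cons mxE unlift_none /=; congr pair.
by apply/rowP => i; rewrite !mxE liftK.
Qed.

Lemma measurable_rV_cons n : measurable_fun setT (@rV_cons n).
Proof.
apply: measurable_fun_rV => i; rewrite /rV_coord /rV_cons /comp /=.
under eq_fun do rewrite mxE.
case: (unliftP ord0 i) => [j _|_] /=; last exact: measurable_fst.
exact: (measurableT_comp (measurable_rV_coord j) measurable_snd).
Qed.

Lemma measurable_rV_uncons n : measurable_fun setT (@rV_uncons n).
Proof.
apply/measurable_fun_pairP; split.
  exact: (measurable_rV_coord (ord0 : 'I_n.+1)).
apply: measurable_fun_rV => i; rewrite /rV_coord /comp /=.
under eq_fun do rewrite mxE.
exact: (measurable_rV_coord (lift ord0 i)).
Qed.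

Section step.
Context (n : nat) (m : {sigma_finite_measure set 'rV[R]_n -> \bar R}).

Definition lebesgue_rV_step : set 'rV[R]_n.+1 -> \bar R :=
  pushforward (lebesgue_measure \x m) (@rV_cons n).

Let step0 : lebesgue_rV_step set0 = 0.
Proof. by rewrite /lebesgue_rV_step /pushforward preimage_set0 measure0. Qed.

Let step_ge0 A : 0 <= lebesgue_rV_step A.
Proof. by rewrite /lebesgue_rV_step /pushforward measure_ge0. Qed.

Let step_sigma_additive : semi_sigma_additive lebesgue_rV_step.
Proof.
move=> F mF tF mUF; rewrite /lebesgue_rV_step /pushforward preimage_bigcup.
have mc := @measurable_rV_cons n.
apply: measure_semi_sigma_additive.
- by move=> k; rewrite -[X in measurable X]setTI; exact: mc.
- apply/trivIsetP => /= i j _ _ ij; rewrite -preimage_setI.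
  by move/trivIsetP : tF => /(_ _ _ _ _ ij) ->//; rewrite preimage_set0.
- by rewrite -preimage_bigcup -[X in measurable X]setTI; exact: mc.
Qed.

HB.instance Definition _ := isMeasure.Build _ _ _ lebesgue_rV_step
  step0 step_ge0 step_sigma_additive.

Let step_sigma_finite : sigma_finite setT lebesgue_rV_step.
Proof.
have /sigma_finiteP[F [TF ndF Foo]] := sigma_finiteT (@lebesgue_measure R).
have /sigma_finiteP[G [TG ndG Goo]] := sigma_finiteT m.
exists (fun k => @rV_uncons n @^-1` (F k `*` G k)).
  rewrite -preimage_bigcup; apply/esym; rewrite -subTset => x _ /=.
  have : setT (rV_uncons x).1 by []. rewrite TF => -[i _ Fi].
  have : setT (rV_uncons x).2 by []. rewrite TG => -[j _ Gj].
  exists (maxn i j) => //; split.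
    by move: Fi; exact/subsetPset/ndF/leq_maxl.
  by move: Gj; exact/subsetPset/ndG/leq_maxr.
move=> k; have [? ?] := Foo k; have [? ?] := Goo k; split.
  rewrite -[X in measurable X]setTI; apply: measurable_rV_uncons => //.
  exact: measurableX.
rewrite /lebesgue_rV_step /pushforward -comp_preimage.
rewrite (_ : _ \o _ = id); last by apply/funext => p /=; rewrite rV_consK.
by rewrite preimage_id product_measure1E// lte_mul_pinfty// ge0_fin_numE.
Qed.

HB.instance Definition _ := Measure_isSigmaFinite.Build _ _ _ lebesgue_rV_step
  step_sigma_finite.
End step.

Fixpoint lebesgue_rV (n : nat) : {sigma_finite_measure set 'rV[R]_n -> \bar R} :=
  match n with
  | 0 => \d_(0%R : 'rV[R]_0)
  | n'.+1 => lebesgue_rV_step (lebesgue_rV n')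
  end.

Lemma lebesgue_rV_box n (A : 'I_n -> set (measurableTypeR R)) :
  (forall i, measurable (A i)) ->
  lebesgue_rV n [set x | forall i, A i (x ord0 i)] =
  \prod_(i < n) lebesgue_measure (A i).
Proof.
elim: n A => [|n IH] A mA.
  rewrite big_ord0 /= diracE (_ : _ \in _ = true)//.
  by apply/mem_set => -[].
rewrite big_ord_recl -IH//= /lebesgue_rV_step /pushforward.
have mB : measurable [set x : 'rV[R]_n | forall i, A (lift ord0 i) (x ord0 i)].
  rewrite (_ : mkset _ = \bigcap_(i in [set: 'I_n])
    (@rV_coord R n i @^-1` A (lift ord0 i))); last first.
    by apply/seteqP; split=> x /= => [h i _|h i]; [exact: h|exact: (h i)].
  apply: fin_bigcap_measurable => // i _.
  rewrite -[X in measurable X]setTI.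
  exact: (measurable_rV_coord i).
rewrite -product_measure1E//.
congr (_ _); apply/seteqP; split=> -[a v] /=.
  move=> h; split; first by have := h ord0; rewrite mxE unlift_none.
  by move=> i; have := h (lift ord0 i); rewrite mxE liftK.
move=> [h0 h] i; rewrite mxE.
by case: (unliftP ord0 i) => [j ->|->] //=; exact: h.
Qed.
End lebesgue_rV.

Section geometry.
Context (R : realType) (d : nat).
Implicit Types (x y : 'rV[R]_d) (K D : set 'rV[R]_d) (r : R).

(** The norm of the library on 'rV[R]_d is the sup norm; it induces the same
    topology. *)
Definition enorm x : R := Num.sqrt (\sum_i x ord0 i ^+ 2).

Definition eball x r : set 'rV[R]_d := [set y | enorm (x - y) < r].

Definition dist_to K x : R := inf [set enorm (x - y) | y in K].

Definition neighborhood K r : set 'rV[R]_d := [set x | dist_to K x <= r].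

Definition boundary D : set 'rV[R]_d := closure D `\` D^°.

Definition path_connected D : Prop := forall x y, D x -> D y ->
  exists f : R -> 'rV[R]_d,
    [/\ {within `[0, 1]%classic, continuous f}, f @` `[0, 1]%classic `<=` D,
        f 0 = x & f 1 = y].

(** Every loop in [D] is homotopic in [D], relative to its base point, to the
    constant loop; the homotopy is H : (time on the loop, parameter). *)
Definition loops_contractible D : Prop :=
  forall f : R -> 'rV[R]_d,
    {within `[0, 1]%classic, continuous f} -> f @` `[0, 1]%classic `<=` D ->
    f 0 = f 1 ->
    exists H : R * R -> 'rV[R]_d,
      [/\ {within `[0, 1]%classic `*` `[0, 1]%classic, continuous H},
          H @` (`[0, 1]%classic `*` `[0, 1]%classic) `<=` D,
          (forall s, s \in `[0, 1] -> H (s, 0) = f s /\ H (s, 1) = f 0) &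
          (forall u, u \in `[0, 1] -> H (0, u) = f 0 /\ H (1, u) = f 0)].

Definition simply_connected D : Prop :=
  path_connected D /\ loops_contractible D.

End geometry.

Section brownian_bridge.
Context (R : realType) (d : nat).
Implicit Types (x y z : 'rV[R]_d) (s t u : R).

(** Transition density of the Brownian motion with generator Delta (not
    Delta / 2). *)
Definition heat_kernel t x y : R :=
  (4 * pi * t) `^ (- (d%:R / 2)) * expR (- (enorm (x - y) ^+ 2 / (4 * t))).

(** Continuous paths [0, t] -> R^d are represented by functions on R that are
    continuous on [0, t] and constant on both sides of it, so that each
    continuous path on [0, t] has exactly one representative (for t >= 0). *)
Record cpath t := CPath {
  cpath_fun :> R -> 'rV[R]_d;
  cpath_continuous : {within `[0, t]%classic, continuous cpath_fun};
  cpath_before : forall s, s <= 0 -> cpath_fun s = cpath_fun 0;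
  cpath_after : forall s, t <= s -> cpath_fun s = cpath_fun t }.

Definition cpath0 t : cpath t.
Proof.
by apply: (@CPath t (cst 0)) => //; apply: continuous_subspaceT; exact: cst_continuous.
Defined.

HB.instance Definition _ t := gen_eqMixin (cpath t).
HB.instance Definition _ t := gen_choiceMixin (cpath t).
HB.instance Definition _ t := isPointed.Build (cpath t) (cpath0 t).

Definition cpath_events t : set (set (cpath t)) :=
  [set E | exists s (A : set 'rV[R]_d),
     [/\ s \in `[0, t], measurable A & E = [set Y : cpath t | A (Y s)]]].

(** Path space with the sigma-algebra generated by the evaluations on [0, t]. *)
Definition path_space t := g_sigma_algebraType (@cpath_events t).

Definition cylinder t (l : seq (R * set 'rV[R]_d)) : set (path_space t) :=
  [set Y : path_space t | {in l, forall sA, sA.2 (Y sA.1)}].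

(** For l = [:: (s1, A1); ...; (sn, An)], the iterated integral over
    z1 \in A1, ..., zn \in An of
    p_(s1 - s0)(x, z1) p_(s2 - s1)(z1, z2) ... p_(t - sn)(zn, y): for s0 = 0, the
    mass that the bridge measure gives to [cylinder l]. *)
Fixpoint cylinder_mass s0 x (l : seq (R * set 'rV[R]_d)) t y : \bar R :=
  if l is (s, A) :: l' then
    (\int[lebesgue_rV R d]_(z in A)
      ((heat_kernel (s - s0) x z)%:E * cylinder_mass s z l' t y))%E
  else (heat_kernel (t - s0) x y)%:E.

(** The Brownian bridge measure from x to y in time t, with total mass p_t(x, y)
    (the case of the empty list below); these conditions determine it. *)
Definition is_brownian_bridge t x y (mu : {measure set (path_space t) -> \bar R}) :
    Prop :=
  mu (~` [set Y : path_space t | Y 0 = x /\ Y t = y]) = 0%E /\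
  forall l : seq (R * set 'rV[R]_d),
    path <%R 0 (rcons (map fst l) t) ->
    {in l, forall sA, measurable sA.2} ->
    mu (cylinder l) = cylinder_mass 0 x l t y.

(** The kernel p_t^V(x, y) of the Feynman-Kac semigroup, [mu t x y] being the
    Brownian bridge measure; V may take the value +oo, and [expeR -oo = 0]. *)
Definition feynman_kac_kernel
    (mu : forall t x y, {measure set (path_space t) -> \bar R})
    (V : 'rV[R]_d -> \bar R) t x y : \bar R :=
  (\int[mu t x y]_(Y in [set: path_space t])
     expeR (- \int[lebesgue_measure]_(s in `[0%R, t]) V (Y s)))%E.

Definition separates (p : R -> 'rV[R]_d -> 'rV[R]_d -> \bar R)
    (D : set 'rV[R]_d) : Prop :=
  forall t x y, 0 < t -> D x -> (~` D) y -> p t x y = 0%E.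

(** The potential d_K^(-beta), equal to +oo on K when K is closed. *)
Definition dist_potential (K : set 'rV[R]_d) (beta : R) (x : 'rV[R]_d) : \bar R :=
  if dist_to K x == 0 then +oo%E else (dist_to K x `^ (- beta))%:E.

End brownian_bridge.

(* Main.v *)
From HB Require Import structures.
Require Import Defs.
From mathcomp Require Import all_boot all_order all_algebra.
From mathcomp Require Import all_classical all_reals all_analysis.
From mathcomp Require Import measurable_realfun ring lra zify.
Import Order.TTheory GRing.Theory Num.Theory.
Import numFieldNormedType.Exports.

Set Implicit Arguments.
Unset Strict Implicit.
Unset Printing Implicit Defensive.

Local Open Scope classical_set_scope.
Local Open Scope ring_scope.

(** If [alpha + beta < d], the potential [V = d_K^-beta] is integrable along
    almost every bridge path, so that the weight [exp (- int_0^t V (Y_s) ds)] is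
    positive almost everywhere. By Tonelli it suffices that
    [int_0^t E [V (Y_s)] ds] is finite, [E] being the integral against the
    bridge measure [mu] from [x] to [y].

    Let [delta = d - alpha], so that [beta < delta < 2]. The point is the bound
      [mu {Y | d_K (Y_s) <= gamma} <= C sigma^(-delta/2) gamma^delta]
    for [0 < gamma <= 1] and [sigma = min s (t - s)]
    (lemma [bridge_neighborhood_le]). It implies, by slicing the values of [d_K]
    dyadically (lemma [integral_negpow_le]), that [E [V (Y_s)]] is at most
    [C' + C' sigma^(-delta/2)], because [beta < delta]; and this is integrable
    over [[0, t]] because [delta < 2]. That last integral is again one of a
    negative power, of [min s (t - s)], and the same slicing lemma applies.

    To prove the bound, take [r] proportional to [sqrt sigma]. If [gamma > r],
    the total mass of [mu] suffices. If [gamma <= r], then one of the two heat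
    kernels in the density [p_s (x, z) p_(t - s) (z, y)] of [Y_s] has a time at
    least [t / 2], hence is bounded; the other one lives at scale [r], where the
    hypothesis bounds the volume of [K_gamma] in every ball of radius [r] by
    [C1 r^alpha gamma^delta]. The balls of radius [2^k r] are covered by [N^k]
    balls of radius [r] (lemma [measure_eball_doubling]), and the Gaussian
    decays faster than any power of the distance, in particular faster than
    [(2 N)^-k] (lemma [expR_sqr_le_dyadic]); so the far shells only contribute a
    geometric series (lemma [integral_heat_kernel_le]).

    The measurability of [d_K] and of [(Y, s) |-> d_K (Y_s)] comes from the
    Lipschitz continuity of [d_K] and from the continuity of the paths.

    For the first conclusion, [D] and its complement are nonempty, so that the
    positivity just proved contradicts separation when [alpha + beta < d]. *)

(** * The Euclidean norm and the distance to a set *)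

Section euclidean.
Context (R : realType) (d : nat).
Implicit Types (x y z : 'rV[R]_d) (K : set 'rV[R]_d).

Lemma enorm_ge0 x : 0 <= enorm x.
Proof. exact: sqrtr_ge0. Qed.

Lemma sqr_enorm x : enorm x ^+ 2 = \sum_i x ord0 i ^+ 2.
Proof. by rewrite sqr_sqrtr// sumr_ge0// => i _; exact: sqr_ge0. Qed.

Lemma enormN x : enorm (- x) = enorm x.
Proof. by congr Num.sqrt; apply: eq_bigr => i _; rewrite mxE sqrrN. Qed.

Lemma enormB x y : enorm (x - y) = enorm (y - x).
Proof. by rewrite -enormN opprB. Qed.

Lemma enorm0 : enorm (0 : 'rV[R]_d) = 0.
Proof. by rewrite /enorm big1 ?sqrtr0// => i _; rewrite mxE expr0n. Qed.

Lemma enorm_eq0 x : enorm x = 0 -> x = 0.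
Proof.
move=> x0; have : \sum_i x ord0 i ^+ 2 = 0 by rewrite -sqr_enorm x0 expr0n.
move/eqP; rewrite psumr_eq0; last by move=> i _; exact: sqr_ge0.
move=> /allP h; apply/rowP => i; rewrite mxE; apply/eqP.
by have := h i (mem_index_enum _); rewrite /= sqrf_eq0.
Qed.

(** Sum over [i] of [0 <= (x_i |y| - y_i |x|)^2]. *)
Lemma cauchy_schwarz_enorm x y :
  \sum_i x ord0 i * y ord0 i <= enorm x * enorm y.
Proof.
have [/enorm_eq0 ->|x0] := eqVneq (enorm x) 0.
  rewrite enorm0 mul0r big1// => i _; by rewrite mxE mul0r.
have [/enorm_eq0 ->|y0] := eqVneq (enorm y) 0.
  rewrite enorm0 mulr0 big1// => i _; by rewrite mxE mulr0.
have {}x0 : 0 < enorm x by rewrite lt_def x0 enorm_ge0.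
have {}y0 : 0 < enorm y by rewrite lt_def y0 enorm_ge0.
set p := enorm x in x0 *; set q := enorm y in y0 *.
have : 0 <= \sum_i (x ord0 i * q - y ord0 i * p) ^+ 2.
  by apply: sumr_ge0 => i _; exact: sqr_ge0.
rewrite (_ : \sum_i _ =
    q ^+ 2 * \sum_i x ord0 i ^+ 2 + p ^+ 2 * \sum_i y ord0 i ^+ 2 -
    2 * p * q * \sum_i x ord0 i * y ord0 i); last first.
  rewrite !mulr_sumr -big_split/= -sumrB; apply: eq_bigr => i _; ring.
rewrite -!sqr_enorm -/p -/q.
rewrite (_ : _ - _ = 2 * (p * q) * (p * q - \sum_i x ord0 i * y ord0 i));
  last by ring.
by rewrite pmulr_rge0 ?subr_ge0// !mulr_gt0.
Qed.

Lemma enormD x y : enorm (x + y) <= enorm x + enorm y.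
Proof.
rewrite -(ler_pXn2r (n := 2))// ?nnegrE ?addr_ge0 ?enorm_ge0//.
rewrite sqrrD !sqr_enorm.
under eq_bigr do rewrite mxE sqrrD.
rewrite !big_split/= lerD2r lerD2l -mulr2n lerMn2r/=.
exact: cauchy_schwarz_enorm.
Qed.

Lemma enorm_triangle z x y : enorm (x - y) <= enorm (x - z) + enorm (z - y).
Proof. by rewrite (le_trans _ (enormD _ _))// addrA subrK. Qed.

Lemma enorm_le_sum x : enorm x <= \sum_i `|x ord0 i|.
Proof.
rewrite -(ler_pXn2r (n := 2))// ?nnegrE ?sumr_ge0 ?enorm_ge0// sqr_enorm.
rewrite expr2 mulr_suml ler_sum// => i _.
rewrite -[leLHS]real_normK ?num_real// expr2 ler_wpM2l// (bigD1 i)//= lerDl.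
exact: sumr_ge0.
Qed.

Lemma measurable_enormB y :
  measurable_fun [set: 'rV[R]_d] (fun x => enorm (y - x)).
Proof.
apply: (measurableT_comp (continuous_measurable_fun (@sqrt_continuous R))).
apply: measurable_sum => i; apply: measurable_funX.
under eq_fun do rewrite !mxE.
apply: measurable_funB => //; exact: measurable_rV_coord.
Qed.

Lemma measurable_eball x r : measurable (eball x r).
Proof.
rewrite /eball -[X in measurable X]setTI.
rewrite (_ : [set y | _] = (fun y => enorm (x - y)) @^-1` `]-oo, r[).
  exact: (measurable_enormB x).
by apply/seteqP; split=> y /=; rewrite in_itv.
Qed.

Lemma dist_to_ge0 K x : 0 <= dist_to K x.
Proof.
have [K0|/set0P[y Ky]] := eqVneq K set0.
  by rewrite /dist_to K0 image_set0 inf0.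
apply: lb_le_inf; first by exists (enorm (x - y)), y.
by move=> _ [z _ <-]; exact: enorm_ge0.
Qed.

Lemma dist_to_le K x y : dist_to K x <= dist_to K y + enorm (x - y).
Proof.
have [K0|/set0P[w Kw]] := eqVneq K set0.
  by rewrite /dist_to K0 !image_set0 inf0 add0r enorm_ge0.
rewrite -lerBlDr; apply: lb_le_inf; first by exists (enorm (y - w)), w.
move=> _ [z Kz <-]; rewrite lerBlDr addrC.
apply: le_trans (enorm_triangle y x z); apply: ge_inf; last by exists z.
by exists 0 => _ [v _ <-]; exact: enorm_ge0.
Qed.

Lemma enorm_rat_approx x e : 0 < e ->
  exists q : 'rV[rat]_d, enorm (x - map_mx ratr q) < e.
Proof.
move=> e0; have e1 : 0 < e / d.+1%:R by rewrite divr_gt0.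
have H i : exists q : rat, ratr q \in `](x ord0 i), (x ord0 i + e / d.+1%:R)[.
  by apply: rat_in_itvoo; rewrite ltrDl.
exists (\row_i projT1 (cid (H i))); apply: le_lt_trans (enorm_le_sum _) _.
apply: (@le_lt_trans _ _ (\sum_(i < d) e / d.+1%:R)).
  apply: ler_sum => i _; rewrite !mxE; case: cid => q /=.
  rewrite in_itv/= => /andP[q1 q2].
  by rewrite ler0_norm ?subr_le0 ?(ltW q1)// opprB lerBlDl ltW.
rewrite sumr_const card_ord -[_ *+ d]mulr_natr mulrAC ltr_pdivrMr//.
by rewrite ltr_pM2l// ltr_nat.
Qed.

(** A 1-Lipschitz function is the infimum of the countably many cones
    [f q + |x - q|] with [q] rational, so its sublevel sets are countable unions
    of balls. The sigma-algebra at hand is generated by the coordinates, so that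
    continuity alone does not give measurability at once. *)
Lemma measurable_dist_to K : measurable_fun [set: 'rV[R]_d] (dist_to K).
Proof.
move=> mD; apply: (measurability _ (RGenInftyO.measurableE R)) => //.
move=> _ [_ [a ->] <-]; rewrite setTI.
rewrite (_ : _ @^-1` _ = \bigcup_(q : 'rV[rat]_d)
    eball (map_mx ratr q) (a - dist_to K (map_mx ratr q))).
  apply: countable_bigcupT_measurable; first exact: countableP.
  by move=> q; exact: measurable_eball.
apply/seteqP; split=> [x/=|x [q _]].
  rewrite in_itv/= -subr_gt0 => fa.
  have [|q xq] := @enorm_rat_approx x ((a - dist_to K x) / 2).
    by rewrite divr_gt0.
  exists q => //=; rewrite /eball/= enormB.
  have := dist_to_le K (map_mx ratr q) x; rewrite enormB; lra.
rewrite /eball/= in_itv/= enormB; have := dist_to_le K x (map_mx ratr q); lra.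
Qed.

Lemma measurable_neighborhood K r : measurable (neighborhood K r).
Proof.
rewrite /neighborhood -[X in measurable X]setTI.
rewrite (_ : [set x | _] = dist_to K @^-1` `]-oo, r]).
  exact: (measurable_dist_to K).
by apply/seteqP; split=> x /=; rewrite in_itv.
Qed.

End euclidean.

(** * Integrals of negative powers by dyadic slicing *)

Section layers.
Context (R : realType).
Local Open Scope ereal_scope.

Lemma nneseries_geometric (a z : R) : (0 <= z < 1)%R ->
  \sum_(0 <= k <oo) (a * z ^+ k)%:E = (a / (1 - z))%:E.
Proof.
move=> /andP[z0 z1]; apply/cvg_lim => //.
have -> : (fun n => \sum_(0 <= k < n) (a * z ^+ k)%:E) =
    EFin \o series (geometric a z).
  by apply/funext => n; rewrite /= sumEFin.
by apply: cvg_EFin; [exact: nearW|apply: cvg_geometric_series; rewrite ger0_norm].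
Qed.

Lemma powR_exprn (a y : R) k : (0 <= a)%R -> ((a ^+ k) `^ y = (a `^ y) ^+ k)%R.
Proof. by move=> a0; rewrite -!powR_mulrn ?powR_ge0// -!powRrM mulrC. Qed.

Lemma powRV (a y : R) : (0 <= a)%R -> (a^-1 `^ y = (a `^ y)^-1)%R.
Proof. by move=> a0; rewrite -!powR_inv1 ?powR_ge0// powRAC. Qed.

Lemma powR2_subr_lt1 (a b : R) : (a < b)%R -> (2 `^ (a - b) < 1 :> R)%R.
Proof.
move=> ab; rewrite -(opprB b) powRN invf_lt1 ?powR_gt0//.
have : (1 `^ (b - a) < 2 `^ (b - a) :> R)%R.
  by apply: gt0_ltr_powR; rewrite ?nnegrE ?subr_gt0// ltr1n.
by rewrite powR1.
Qed.

Lemma nneseries_ge_term (u : nat -> \bar R) k : (forall n, 0 <= u n) ->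
  u k <= \sum_(0 <= n <oo) u n.
Proof.
move=> u0; apply: le_trans (nneseries_lim_ge k.+1 _) => //.
by rewrite big_nat_recr//= leeDr// sume_ge0.
Qed.

(** [dist_potential K beta x] is [negpow beta (dist_to K x)] by definition. *)
Definition negpow (beta u : R) : \bar R :=
  if (u == 0)%R then +oo else (u `^ (- beta))%:E.

Lemma negpow_ge0 beta u : 0 <= negpow beta u.
Proof. by rewrite /negpow; case: ifP => // _; rewrite lee_fin powR_ge0. Qed.

Lemma measurable_negpow beta : measurable_fun [set: R] (negpow beta).
Proof.
apply: measurable_fun_ifT => //; first exact: measurable_fun_eqr.
by apply/measurable_EFinP; exact: measurable_powR.
Qed.

Lemma dyadic_ceil (u : R) : (0 <= u)%R -> exists2 m : nat, (u < 2 ^+ m)%R &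
  forall j, m = j.+1 -> (2 ^+ j <= u)%R.
Proof.
move=> u0.
have H : exists m : nat, (u < 2 ^+ m)%R.
  exists (Num.truncn u).+1; have /andP[_ /lt_trans] := truncn_itv u0; apply.
  by rewrite -natrX ltr_nat ltn_expl.
exists (ex_minn H); first by case: ex_minnP.
case: ex_minnP => m _ min j mj; rewrite leNgt; apply/negP => /min.
by rewrite mj ltnn.
Qed.

(** On the k-th slice [2^-(k+1) < u <= 2^-k], [u^-beta] is at most
    [2^(beta (k+1))]; taking [u <= 2^-k] as the condition loses only a constant
    after summation and also covers [u = 0], where all the terms are at least
    1. *)
Definition layer (beta u : R) (k : nat) : \bar R :=
  ((2 `^ beta) ^+ k.+1 * (u <= (2 ^+ k)^-1)%R%:R)%:E.

Lemma layer_ge0 beta u k : 0 <= layer beta u k.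
Proof. by rewrite lee_fin mulr_ge0// exprn_ge0// powR_ge0. Qed.

Lemma negpow_le_layers (beta u : R) : (0 < beta)%R -> (0 <= u)%R ->
  negpow beta u <= 1 + \sum_(0 <= k <oo) layer beta u k.
Proof.
move=> beta0 u0; have T0 := layer_ge0 beta u.
have q1 : (1 <= 2 `^ beta :> R)%R by rewrite -[leLHS](powRr0 2) ler_powR ?ler1n// ltW.
rewrite /negpow; case: ifPn => [/eqP u_eq0|u_neq0].
  rewrite (_ : \sum_(0 <= k <oo) _ = +oo) ?addey//.
  apply/eq_infty => r.
  have [n rn] : exists n : nat, (r <= n%:R)%R.
    exists (Num.truncn `|r|).+1; rewrite (le_trans (ler_norm r))// ltW//.
    exact: truncnS_gt.
  apply: le_trans (nneseries_lim_ge n _) => //.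
  apply: (@le_trans _ _ (\sum_(0 <= i < n) 1)).
    by rewrite sumEFin lee_fin sumr_const_nat subn0.
  apply: lee_sum => i _; rewrite /layer u_eq0 invr_ge0 exprn_ge0// mulr1 lee_fin.
  by rewrite exprn_ege1.
have {u_neq0}u_gt0 : (0 < u)%R by rewrite lt_def u_neq0.
have [m um mu] := @dyadic_ceil u^-1 ltac:(by rewrite invr_ge0).
have uB (j : nat) : (u^-1 <= 2 ^+ j)%R -> (u `^ (- beta) <= (2 `^ beta) ^+ j)%R.
  move=> uj; rewrite -mulN1r powRrM powR_inv1 ?(ltW u_gt0)//.
  rewrite -powR_exprn//.
  by apply: ge0_ler_powR; rewrite ?nnegrE ?invr_ge0 ?exprn_ge0// ltW.
case: m um mu => [|k] um mu.
  apply: (@le_trans _ _ 1); last by rewrite leeDl// nneseries_ge0.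
  by rewrite lee_fin (le_trans (uB 0%N (ltW um))).
apply: (@le_trans _ _ (layer beta u k)).
  rewrite /layer (_ : (u <= _)%R = true) ?mulr1 ?lee_fin ?uB ?(ltW um)//.
  by rewrite -[u]invrK lef_pV2 ?posrE ?invr_gt0 ?exprn_gt0// mu.
apply: le_trans (nneseries_ge_term k T0) _.
by rewrite leeDr.
Qed.

(** The slice [f <= 2^-k] contributes at most
    [2^(beta (k+1)) C 2^(- delta k)], a geometric series since [beta < delta];
    the part where [f > 1] contributes at most the mass of [A]. *)
Lemma integral_negpow_le d (T : measurableType d) (m : {measure set T -> \bar R})
    (A : set T) (f : T -> R) (beta delta C : R) :
  measurable A -> measurable_fun A f -> (forall x, A x -> (0 <= f x)%R) ->
  (0 < beta)%R -> (beta < delta)%R ->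
  (forall gamma, (0 < gamma <= 1)%R ->
    m (A `&` [set x | (f x <= gamma)%R]) <= (C * gamma `^ delta)%:E) ->
  \int[m]_(x in A) negpow beta (f x) <=
    m A + (C * (2 `^ beta / (1 - 2 `^ (beta - delta))))%:E.
Proof.
move=> mA mf f0 beta0 bd mC.
have mfle r : measurable (A `&` [set x | (f x <= r)%R]).
  rewrite (_ : [set x | (f x <= r)%R] = f @^-1` `]-oo, r]%classic).
    exact: (mf mA _ (measurable_itv _)).
  by apply: eq_set => x /=; rewrite in_itv.
pose S k := A `&` [set x | (f x <= (2 ^+ k)^-1)%R].
pose g k x : \bar R := ((2 `^ beta) ^+ k.+1)%:E * (\1_(S k) x)%:E.
have g0 k x : 0 <= g k x by rewrite mule_ge0// lee_fin exprn_ge0// powR_ge0.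
have mS k : measurable (S k) by exact: mfle.
have mg k D : measurable_fun D (g k).
  apply: emeasurable_funM => //.
  by apply/measurable_EFinP; exact: (measurable_indic (mS k)).
have gE x k : A x -> layer beta (f x) k = g k x.
  move=> Ax; rewrite /layer /g indicE EFinM.
  congr (_ * (_ : bool)%:R%:E).
  by apply/idP/idP => [h|/set_mem[_]//]; apply/mem_set.
have mg_sum : measurable_fun A (fun x => \sum_(0 <= k <oo) g k x).
  by apply: ge0_emeasurable_sum.
apply: (@le_trans _ _ (\int[m]_(x in A) (cst 1 x + \sum_(0 <= k <oo) g k x))).
  apply: ge0_le_integral => //.
  - by move=> x _; exact: negpow_ge0.
  - by apply: measurableT_comp => //; exact: measurable_negpow.
  - exact: emeasurable_funD.
  - move=> x Ax; apply: le_trans (negpow_le_layers beta0 (f0 x Ax)) _.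
    by rewrite (eq_eseriesr (fun k _ => gE x k Ax)).
rewrite ge0_integralD//; last by move=> x _; exact: nneseries_ge0.
rewrite integral_cst// mul1e leeD2l// integral_nneseries// mulrA.
rewrite -nneseries_geometric; last first.
  by rewrite powR_ge0/= powR2_subr_lt1.
apply: lee_nneseries => [k _ _|k _]; first exact: integral_ge0.
have mI : measurable_fun A (EFin \o (\1_(S k) : T -> R)).
  by apply/measurable_EFinP; exact: (measurable_indic (mS k)).
have q0 : (0 <= (2 `^ beta) ^+ k.+1 :> R)%R by rewrite exprn_ge0// powR_ge0.
rewrite (ge0_integralZl_EFin m mA _ mI q0); last first.
  by move=> x _; rewrite /= lee_fin indicE.
rewrite integral_indic// /S setIAC setIid.
apply: (@le_trans _ _
    (((2 `^ beta) ^+ k.+1)%:E * (C * (2 ^+ k)^-1 `^ delta)%:E)).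
  apply: lee_wpmul2l; first by rewrite lee_fin exprn_ge0// powR_ge0.
  apply: mC; rewrite invr_gt0 exprn_gt0//=.
  by rewrite invf_le1 ?exprn_gt0// exprn_ege1// ler1n.
rewrite -EFinM lee_fin le_eqVlt; apply/orP; left; apply/eqP.
rewrite powRV ?exprn_ge0// powR_exprn// powRB ?pnatr_eq0 ?implybT//.
rewrite expr_div_n exprS; ring.
Qed.
End layers.

(** * Gaussian integrals over sets of controlled local volume *)

Section gauss.
Context (R : realType).

(** If [2^j <= u < 2^(j+1)], then [exp (- a u^2) <= N! / (a 4^j)^N], and
    [4^N >= 2 N] turns this into a multiple of [(2 N)^-j]. *)
Lemma expR_sqr_le_dyadic (a : R) (N : nat) : 0 < a -> (0 < N)%N ->
  exists2 A : R, 0 <= A & forall u, 0 <= u ->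
    ((expR (- (a * u ^+ 2)))%:E <=
     \sum_(0 <= k <oo) (A * (2 * N%:R)^-1 ^+ k * (u < 2 ^+ k)%R%:R)%:E)%E.
Proof.
move=> a0 N0; pose M : R := 2 * N%:R.
have M0 : 0 < M by rewrite mulr_gt0// ltr0n.
pose A : R := 1 + N`!%:R * a ^- N * M.
have B0 : 0 <= N`!%:R * a ^- N * M.
  by rewrite !mulr_ge0 ?invr_ge0 ?exprn_ge0// ltW.
have A0 : 0 <= A by rewrite addr_ge0.
exists A => // u u0.
have [m um mu] := dyadic_ceil u0.
apply: (@le_trans _ _ (A * M^-1 ^+ m * (u < 2 ^+ m)%R%:R)%:E); last first.
  apply: (@nneseries_ge_term _ (fun k =>
    (A * M^-1 ^+ k * (u < 2 ^+ k)%R%:R)%:E) m) => k.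
  by rewrite lee_fin !mulr_ge0// exprn_ge0// invr_ge0 ltW.
rewrite um mulr1 lee_fin; case: m um mu => [|j] um mu.
  rewrite expr0 mulr1 (@le_trans _ _ 1)//; last by rewrite lerDl.
  rewrite -expR0 ler_expR oppr_le0; apply: mulr_ge0; first exact: ltW.
  exact: sqr_ge0.
have {mu}ju := mu j erefl.
have x0 : 0 < a * 4 ^+ j by rewrite mulr_gt0// exprn_gt0.
have xu : a * 4 ^+ j <= a * u ^+ 2.
  rewrite ler_pM2l// (_ : 4 = 2 ^+ 2); last by rewrite expr2 -natrM.
  by rewrite exprAC lerXn2r// ?nnegrE// exprn_ge0.
rewrite expRN; apply: (@le_trans _ _ ((a * 4 ^+ j) ^+ N / N`!%:R)^-1).
  rewrite lef_pV2 ?posrE ?expR_gt0 ?divr_gt0 ?exprn_gt0 ?ltr0n ?fact_gt0//.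
  apply: (@le_trans _ _ (expR (a * 4 ^+ j))); last by rewrite ler_expR.
  rewrite -(prednK N0); apply: le_trans; last exact: (expR_ge1Dxn N.-1 (ltW x0)).
  by rewrite lerDr.
apply: (@le_trans _ _ (N`!%:R * a ^- N * M * M^-1 ^+ j.+1)); last first.
  by rewrite ler_wpM2r ?lerDr// exprn_ge0// invr_ge0 ltW.
rewrite invf_div exprMn invfM -[leRHS]mulrA -[leRHS]mulrA ler_pM2l ?ltr0n ?fact_gt0//.
rewrite ler_pM2l ?invr_gt0 ?exprn_gt0//.
have -> : M * M^-1 ^+ j.+1 = (M ^+ j)^-1.
  by rewrite exprS mulrA mulfV ?mul1r ?exprVn ?gt_eqF.
rewrite lef_pV2 ?posrE ?exprn_gt0// exprAC lerXn2r ?nnegrE ?exprn_ge0 ?(ltW M0)//.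
rewrite /M -natrM -natrX ler_nat -(prednK N0) expnS.
by have := @ltn_expl 4 N.-1 isT; lia.
Qed.
End gauss.

Section covering.
Context (R : realType) (d : nat).
Implicit Types (x y z : 'rV[R]_d).

Lemma coord_le_enorm x i : `|x ord0 i| <= enorm x.
Proof.
rewrite -sqrtr_sqr ler_sqrt ?sumr_ge0// => [|j _]; last exact: sqr_ge0.
by rewrite (bigD1 i)//= lerDl sumr_ge0// => j _; exact: sqr_ge0.
Qed.

(* Cutting [[-1, 1]] into steps of length [1 / M] in each of the d directions
   displaces a point by at most [sqrt d / M < 1 / 2]. *)
Local Notation M := (d.*2.+1).
Local Notation J := {ffun 'I_d -> 'I_(M.*2.+1)}.

Definition grid_point (j : J) : 'rV[R]_d := \row_i ((j i)%:R / M%:R - 1).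

(** [w i] below is the position of [y] along the i-th axis in grid units, the
    grid spanning the cube of half side [2 r] centered at [x]. *)
Lemma eball_double_cover x (r : R) : 0 < r ->
  eball x (2 * r) `<=` \bigcup_(j in [set: J]) eball (x + (2 * r) *: grid_point j) r.
Proof.
move=> r0 y; rewrite /eball/= => xy.
have M0 : 0 < M%:R :> R by rewrite ltr0n.
have r20 : 0 < 2 * r by rewrite mulr_gt0.
pose w i := ((y ord0 i - x ord0 i) / (2 * r) + 1) * M%:R.
have w_itv i : 0 <= w i < 2 * M%:R.
  have : `|(x - y) ord0 i| < 2 * r by apply: le_lt_trans xy; exact: coord_le_enorm.
  rewrite !mxE distrC ltr_norml => /andP[w1 w2]; apply/andP; split.
    rewrite mulr_ge0// ?(ltW M0)// -lerBlDr sub0r ler_pdivlMr//.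
    by rewrite mulN1r ltW.
  by rewrite ltr_pM2r// -ltrBrDr ltr_pdivrMr// (_ : 2 - 1 = 1) ?mul1r//; ring.
pose j : J := [ffun i => inord (Num.truncn (w i))].
have jE i : (j i : nat) = Num.truncn (w i).
  have /andP[w0 w1] := w_itv i.
  rewrite ffunE inordK// ltnS ltnW// -(ltr_nat R) -mul2n natrM.
  by apply: le_lt_trans w1; have /andP[] := truncn_itv w0.
exists j => //=.
rewrite -(ltr_pXn2r (n := 2))// ?nnegrE ?enorm_ge0 ?(ltW r0)// sqr_enorm.
have q0 : 0 <= 2 * r / M%:R by rewrite divr_ge0 ?(ltW r20).
apply: (@le_lt_trans _ _ (\sum_(i < d) (2 * r / M%:R) ^+ 2)).
  apply: ler_sum => i _; rewrite -[leLHS]real_normK ?num_real//.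
  rewrite lerXn2r ?nnegrE// !mxE jE.
  have /andP[w0 _] := w_itv i; have /andP[] := truncn_itv w0.
  set n := Num.truncn _ => nw wn.
  have -> : x ord0 i + 2 * r * (n%:R / M%:R - 1) - y ord0 i =
      2 * r / M%:R * (n%:R - w i).
    by rewrite /w; field; rewrite !gt_eqF.
  rewrite normrM ger0_norm// ler_piMr//.
  rewrite ler_norml; move: wn nw; rewrite -natr1; lra.
rewrite sumr_const card_ord -[_ *+ d]mulr_natl expr_div_n mulrA ltr_pdivrMr ?exprn_gt0//.
rewrite [ltRHS]mulrC [(2 * r) ^+ 2]exprMn mulrA ltr_pM2r ?exprn_gt0//.
rewrite -!natrX -natrM ltr_nat; nia.
Qed.

Lemma measure_le_cover d' (T : measurableType d') (m : {measure set T -> \bar R})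
   (I : finType) (F : I -> set T) (A : set T) : measurable A ->
  (forall i, measurable (F i)) -> A `<=` \bigcup_(i in [set: I]) F i ->
  (m A <= \sum_i m (F i))%E.
Proof.
move=> mA mF AF.
have := @content_sub_fsum _ _ _ m I setT A F finite_finset (fun i _ => mF i) mA AF.
move=> /le_trans; apply.
rewrite (_ : [set: I] = [set` index_enum I]); last first.
  by apply/seteqP; split => i //= _; exact: mem_index_enum.
by rewrite -fsbig_seq// index_enum_uniq.
Qed.

Lemma measure_eball_doubling (A : set 'rV[R]_d) (r b : R) : measurable A ->
  0 < r -> (forall x, (lebesgue_rV R d (A `&` eball x r) <= b%:E)%E) ->
  forall k x, (lebesgue_rV R d (A `&` eball x (2 ^+ k * r)) <= (#|J|%:R ^+ k * b)%:E)%E.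
Proof.
move=> mA r0 Ab; elim=> [|k IH] x; first by rewrite expr0 !mul1r.
have mAe y s : measurable (A `&` eball y s).
  by apply: measurableI => //; exact: measurable_eball.
have r0k : 0 < 2 ^+ k * r by rewrite mulr_gt0// exprn_gt0.
apply: le_trans (measure_le_cover (F := fun j : J =>
  A `&` eball (x + (2 * (2 ^+ k * r)) *: grid_point j) (2 ^+ k * r)) _ _ _ _) _ => //.
  rewrite exprS -mulrA => y [Ay /(eball_double_cover r0k)[j _ ?]].
  by exists j.
apply: (@le_trans _ _ (\sum_(j : J) (#|J|%:R ^+ k * b)%:E)%E).
  by apply: lee_sum => j _; exact: IH.
by rewrite sumEFin sumr_const -[_ *+ _]mulr_natl exprS mulrA.
Qed.

Lemma measurable_heat_kernel t x : measurable_fun [set: 'rV[R]_d] (heat_kernel t x).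
Proof.
apply: measurable_funM => //; apply: measurableT_comp => //.
apply: measurableT_comp => //; apply: measurable_funM => //.
by apply: measurable_funX; exact: measurable_enormB.
Qed.

(** At time [kappa r^2] the heat kernel is at most [C r^-d], spread over a ball
    of radius [r], up to a tail which the growth [N^k] of the volume of [A] in
    the balls of radius [2^k r] cannot compensate. *)
Lemma integral_heat_kernel_le (kappa : R) : 0 < kappa ->
  exists2 C : R, 0 <= C & forall (A : set 'rV[R]_d) (r b : R) x, measurable A ->
    0 < r -> (forall y, (lebesgue_rV R d (A `&` eball y r) <= b%:E)%E) ->
    (\int[lebesgue_rV R d]_(z in A) (heat_kernel (kappa * r ^+ 2) x z)%:E <=
      (C * r `^ (- d%:R) * b)%:E)%E.
Proof.
move=> k0; have J0 : (0 < #|J|)%N by apply/card_gt0P; exists [ffun=> ord0].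
have J0R : 0 < #|J|%:R :> R by rewrite ltr0n.
have [|A0 A00 HA] := @expR_sqr_le_dyadic R (4 * kappa)^-1 #|J| _ J0.
  by rewrite invr_gt0 mulr_gt0.
pose P := (4 * pi * kappa) `^ (- (d%:R / 2)).
exists (P * A0 * 2); first by rewrite !mulr_ge0// powR_ge0.
move=> A r b x mA r0 Ab.
have Q0 : 0 <= P * r `^ (- d%:R) by rewrite mulr_ge0 ?powR_ge0.
have heatE z : heat_kernel (kappa * r ^+ 2) x z =
    P * r `^ (- d%:R) * expR (- ((4 * kappa)^-1 * (enorm (x - z) / r) ^+ 2)).
  rewrite /heat_kernel; congr (_ * expR (- _)).
    rewrite mulrA powRM ?mulr_ge0 ?pi_ge0 ?exprn_ge0 ?(ltW k0) ?(ltW r0)//.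
    rewrite -/P -powR_mulrn ?(ltW r0)// -powRrM; congr (_ * _ `^ _).
    by rewrite mulrN mulrCA divff ?mulr1.
  by field; rewrite !gt_eqF.
pose c k := P * r `^ (- d%:R) * A0 * (2 * #|J|%:R)^-1 ^+ k.
have c0 k : 0 <= c k.
  by rewrite !mulr_ge0 ?powR_ge0// exprn_ge0// invr_ge0 mulr_ge0// ltW.
pose B k := eball x (2 ^+ k * r).
have mB k : measurable (B k) by exact: measurable_eball.
have mI k : measurable_fun A (EFin \o (\1_(B k) : 'rV[R]_d -> R)).
  by apply/measurable_EFinP; exact: (measurable_indic (mB k)).
pose g k z : \bar R := ((c k)%:E * (\1_(B k) z)%:E)%E.
have g0 k z : (0 <= g k z)%E by rewrite mule_ge0// lee_fin.
have mg k : measurable_fun A (g k).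
  by apply: emeasurable_funM => //; exact: mI.
apply: (@le_trans _ _ (\int[lebesgue_rV R d]_(z in A) \sum_(0 <= k <oo) g k z)%E).
  apply: ge0_le_integral => //.
  - by move=> z _; rewrite lee_fin mulr_ge0 ?powR_ge0 ?expR_ge0.
  - apply/measurable_EFinP; apply: measurable_funTS; exact: measurable_heat_kernel.
  - exact: ge0_emeasurable_sum.
  - move=> z _; rewrite heatE EFinM.
    have u0 : 0 <= enorm (x - z) / r by rewrite divr_ge0 ?enorm_ge0 ?ltW.
    apply: le_trans (lee_wpmul2l _ (HA _ u0)) _; first by rewrite lee_fin.
    rewrite -nneseriesZl; last first.
      by move=> i _; rewrite lee_fin !mulr_ge0// exprn_ge0// invr_ge0 mulr_ge0.
    rewrite le_eqVlt; apply/orP; left; apply/eqP; apply: eq_eseriesr => k _.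
    rewrite /g /c indicE -!EFinM !mulrA; congr (_ * (_ : bool)%:R)%:E.
    rewrite ltr_pdivrMr//.
    by apply/idP/idP => [h|/set_mem//]; apply/mem_set.
rewrite integral_nneseries//.
have -> : P * A0 * 2 * r `^ (- d%:R) * b = P * r `^ (- d%:R) * A0 * b / (1 - 2^-1).
  by field.
rewrite -nneseries_geometric; last by apply/andP; split; lra.
apply: lee_nneseries => [k _ _|k _]; first exact: integral_ge0.
rewrite /g (ge0_integralZl_EFin _ mA _ (mI k) (c0 k)); last first.
  by move=> z _; rewrite /= lee_fin.
rewrite integral_indic// setIC.
apply: (@le_trans _ _ ((c k)%:E * (#|J|%:R ^+ k * b)%:E)%E).
  by apply: lee_wpmul2l; [rewrite lee_fin|exact: measure_eball_doubling].
rewrite -EFinM lee_fin /c invfM exprMn -!mulrA le_eqVlt; apply/orP; left.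
apply/eqP; congr (_ * (_ * (_ * _))); rewrite [RHS]mulrC; congr (_ * _).
by rewrite mulrA -exprMn mulVf ?gt_eqF// expr1n mul1r.
Qed.
End covering.

(** * Path space *)

Section paths.
Context (R : realType) (d : nat).
Implicit Types (x y z : 'rV[R]_d) (K : set 'rV[R]_d) (t : R).

Lemma continuous_dist_to K : continuous (dist_to K).
Proof.
move=> z P /nbhs_ballP[e /= e0 eP].
have e1 : 0 < e / d.+1%:R by rewrite divr_gt0.
apply: (@filterS _ (nbhs z) (nbhs_filter z) _ _ _ (nbhsx_ballx z _ e1)) => w [_ zw].
apply: eP; rewrite -ball_normE /=.
have := dist_to_le K z w; have := dist_to_le K w z; rewrite (enormB w z).
have : enorm (z - w) < e.
  apply: le_lt_trans (enorm_le_sum _) _.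
  apply: (@le_lt_trans _ _ (\sum_(i < d) e / d.+1%:R)).
    by apply: ler_sum => i _; rewrite !mxE ltW//; exact: zw.
  rewrite sumr_const card_ord -[_ *+ d]mulr_natr mulrAC ltr_pdivrMr//.
  by rewrite ltr_pM2l// ltr_nat.
by rewrite ltr_norml; lra.
Qed.

Definition clamp t (s : R) : R := Num.max 0 (Num.min s t).

Lemma clamp_itv t s : 0 <= t -> `[0, t]%classic (clamp t s).
Proof.
move=> t0; rewrite /= in_itv/= /clamp le_max lexx/=.
by rewrite ge_max t0 ge_min lexx orbT.
Qed.

Lemma cpath_clamp t (Y : cpath d t) s : 0 <= t -> Y (clamp t s) = Y s.
Proof.
move=> t0; rewrite /clamp; case: (leP s t) => [st|ts].
  by case: leP => // s0; rewrite [RHS]cpath_before// ltW.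
by rewrite max_r// [RHS]cpath_after// ltW.
Qed.

(** As paths are constant on both sides of [[0, t]], their continuity on
    [[0, t]] extends to the whole line. *)
Lemma continuous_cpath t (Y : cpath d t) : 0 <= t -> continuous Y.
Proof.
move=> t0 s; rewrite /continuous_at -(cpath_clamp _ _ t0).
under eq_cvg => u do rewrite -(cpath_clamp _ _ t0).
have := @cpath_continuous _ _ _ Y => /subspace_continuousP/(_ _ (clamp_itv s t0)).
apply: cvg_comp => P /= wP.
have ccl : clamp t u @[u --> s] --> clamp t s.
  apply: (@continuous_max R R^o (cst 0) (fun u => Num.min u t)).
    exact: cst_continuous.
  apply: (@continuous_min R R^o id (cst t)); first exact: cvg_id.
  exact: cst_continuous.
apply: (@filterS _ (nbhs s) (nbhs_filter s) _ _ _ (ccl _ wP)) => u /=; apply.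
exact: clamp_itv.
Qed.

Lemma measurable_cylinder1 t s (A : set 'rV[R]_d) : 0 <= t -> measurable A ->
  measurable [set Y : path_space d t | A (Y s)].
Proof.
move=> t0 mA; rewrite (_ : mkset _ = [set Y : path_space d t | A (Y (clamp t s))]).
  apply: sub_sigma_algebra; exists (clamp t s), A; split => //.
  exact: clamp_itv.
by apply: eq_set => Y; rewrite cpath_clamp.
Qed.

Lemma measurable_truncn_eq (a : R) k :
  measurable [set s : measurableTypeR R | Num.truncn (a * (s : R)) = k].
Proof.
have ma : measurable_fun [set: measurableTypeR R] (fun s : R => a * s).
  exact: measurable_funM.
pose le_trunc j := [set s : measurableTypeR R | (Num.truncn (a * (s : R)) <= j)%N].
have mle j : measurable (le_trunc j).
  rewrite (_ : le_trunc j = (fun s : R => a * s) @^-1` `]-oo, j.+1%:R[%classic).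
    rewrite -[X in measurable X]setTI.
    exact: (ma measurableT _ (measurable_itv _)).
  by apply/seteqP; split => s; rewrite /le_trunc/= in_itv/= truncn_le_nat.
case: k => [|k].
  rewrite (_ : mkset _ = le_trunc 0%N)//.
  by apply/seteqP; split => s; rewrite /le_trunc/= leqn0 => /eqP.
rewrite (_ : mkset _ = le_trunc k.+1 `\` le_trunc k); first exact: measurableD.
rewrite /le_trunc; apply/seteqP; split => s /=.
  by move->; rewrite leqnn ltnn.
by move=> [u /negP]; rewrite -ltnNge => v; apply/eqP; rewrite eqn_leq u v.
Qed.

(** The map is the limit of its values at the last time of the form
    [k / (n + 1)] before [s], which depend on [s] through an integer only. *)
Lemma measurable_path_eval t (f : 'rV[R]_d -> R) : 0 <= t -> continuous f ->
  measurable_fun setT f ->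
  measurable_fun setT
    (fun p : path_space d t * measurableTypeR R => f ((p.1 : path_space d t) p.2)).
Proof.
move=> t0 cf mf.
pose u (n k : nat) : R := k%:R / n.+1%:R.
pose h n (p : path_space d t * measurableTypeR R) : R :=
  f ((p.1 : path_space d t) (u n (Num.truncn (n.+1%:R * (p.2 : R))))).
apply: (@measurable_fun_cvg _ _ _ setT h).
- move=> n _ B mB; rewrite setTI.
  rewrite (_ : h n @^-1` B = \bigcup_k
      ([set Y : path_space d t | (f @^-1` B) (Y (u n k))] `*`
      [set s : measurableTypeR R | Num.truncn (n.+1%:R * (s : R)) = k])).
    apply: bigcupT_measurable => k; apply: measurableX; last first.
      exact: measurable_truncn_eq.
    by apply: measurable_cylinder1 => //; rewrite -[X in measurable X]setTI; exact: mf.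
  apply/seteqP; split=> [[Y s] /= hB|[Y s] [k _ [/= hB e]]]; last first.
    by rewrite /preimage /h /= e.
  by exists (Num.truncn (n.+1%:R * (s : R))).
- move=> [Y s] _ /=.
  have cfY : {for s, continuous (f \o Y)}.
    by apply: continuous_comp; [exact: continuous_cpath|exact: cf].
  rewrite /h /=; have [s0|s0] := ltP s 0.
    rewrite (_ : (fun n => _) = cst (f (Y s))); first exact: cvg_cst.
    apply/funext => n; have /truncn0Pn -> : ~~ (1 <= n.+1%:R * s).
      by rewrite -ltNge (lt_trans _ ltr01)// pmulr_rlt0 ?ltr0n.
    rewrite /u mul0r.
    by rewrite (@cpath_before _ _ _ Y s) ?(ltW s0).
  suff us : u n (Num.truncn (n.+1%:R * s)) @[n --> \oo] --> s.
    exact: (continuous_cvg _ cfY us).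
  apply/cvgrPdist_le => e e0.
  near=> n.
  have ns0 : 0 <= n.+1%:R * s by rewrite mulr_ge0.
  have n0 : 0 < n.+1%:R :> R by rewrite ltr0n.
  have /andP[ts st] := truncn_itv ns0.
  have -> : s - u n (Num.truncn (n.+1%:R * s)) =
      (n.+1%:R * s - (Num.truncn (n.+1%:R * s))%:R) / n.+1%:R.
    by rewrite /u; field; rewrite gt_eqF.
  rewrite ger0_norm; last by rewrite divr_ge0 ?subr_ge0// ltW.
  apply: (@le_trans _ _ (n.+1%:R^-1)).
    rewrite ler_pdivrMr// mulVf ?gt_eqF//; move: st; rewrite -natr1; lra.
  by rewrite ltW//; near: n; exact: (near_infty_natSinv_lt (PosNum e0)).
Unshelve. all: by end_near. Qed.

Lemma bridge_mass t x y (mu : {measure set (path_space d t) -> \bar R}) : 0 < t ->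
  is_brownian_bridge x y mu -> mu setT = (heat_kernel t x y)%:E.
Proof.
move=> t0 [_ /(_ [::])]; rewrite /= subr0 t0 => <- //.
by congr (mu _); apply/seteqP; split => Y //= _ sA.
Qed.

Lemma bridge_marginal t x y (mu : {measure set (path_space d t) -> \bar R}) s A :
  0 < s < t -> measurable A -> is_brownian_bridge x y mu ->
  mu [set Y : path_space d t | A (Y s)] =
    (\int[lebesgue_rV R d]_(z in A)
      ((heat_kernel s x z)%:E * (heat_kernel (t - s) z y)%:E))%E.
Proof.
move=> st mA [_ /(_ [:: (s, A)])]; rewrite /= subr0 andbT => /(_ st) <-.
  congr (mu _); apply/seteqP; split => Y /=.
    by move=> AY sA; rewrite inE => /eqP ->.
  by move=> /(_ (s, A)); apply; rewrite inE.
by move=> sA; rewrite inE => /eqP ->.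
Qed.

End paths.

(** * Bridges near the set *)

Section bridge_bounds.
Context (R : realType) (d : nat).
Implicit Types (x y z : 'rV[R]_d) (K : set 'rV[R]_d) (t s : R).

Lemma heat_kernel_gt0 t x y : 0 < t -> 0 < heat_kernel t x y.
Proof.
move=> t0; rewrite mulr_gt0 ?expR_gt0// powR_gt0// !mulr_gt0//.
exact: pi_gt0.
Qed.

Lemma heat_kernel_sym t x y : heat_kernel t x y = heat_kernel t y x.
Proof. by rewrite /heat_kernel enormB. Qed.

Lemma heat_kernel_le t s x y : 0 < t -> t <= s ->
  heat_kernel s x y <= (4 * pi * t) `^ (- (d%:R / 2)).
Proof.
move=> t0 ts; have s0 := lt_le_trans t0 ts.
apply: (@le_trans _ _ ((4 * pi * s) `^ (- (d%:R / 2)))).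
  rewrite ler_piMr ?powR_ge0// -expR0 ler_expR oppr_le0 divr_ge0 ?sqr_ge0//.
  by rewrite mulr_ge0// ltW.
have p4 : 0 < 4 * pi :> R by rewrite mulr_gt0// pi_gt0.
have q (u : R) : 0 < u -> 0 < 4 * pi * u by move=> u0; rewrite mulr_gt0.
rewrite !powRN lef_pV2 ?posrE ?powR_gt0 ?q//.
apply: ge0_ler_powR; rewrite ?nnegrE ?divr_ge0 ?(ltW (q _ _))//.
by rewrite ler_pM2l.
Qed.

(** The scale [r = sqrt (sigma / kappa)] is the diffusive one; [kappa = 1 + t]
    only keeps it below 1, where the volume bound is assumed. In both cases the
    mass is at most a constant times [(gamma / r)^delta]. *)
Lemma bridge_neighborhood_le K (alpha C1 t : R) x y
    (mu : {measure set (path_space d t) -> \bar R}) :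
  alpha < d%:R -> 0 < C1 ->
  (forall x (r gamma : R), 0 < gamma -> gamma <= r -> r <= 1 ->
     (lebesgue_rV R d (neighborhood K gamma `&` eball x r) <=
       (C1 * r `^ alpha * gamma `^ (d%:R - alpha))%:E)%E) ->
  0 < t -> is_brownian_bridge x y mu ->
  exists2 C : R, 0 < C & forall s gamma, 0 < s < t -> 0 < gamma <= 1 ->
    (mu [set Y : path_space d t | (dist_to K (Y s) <= gamma)%R] <=
      (C * Num.min s (t - s) `^ (- ((d%:R - alpha) / 2)) *
        gamma `^ (d%:R - alpha))%:E)%E.
Proof.
move=> alphad C10 Kup t0 bmu; pose delta := d%:R - alpha; rewrite -/delta.
have delta0 : 0 < delta by rewrite subr_gt0.
pose kappa := 1 + t; have k0 : 0 < kappa by rewrite addr_gt0.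
have [Cg Cg0 Hg] := @integral_heat_kernel_le R d kappa k0.
pose M := heat_kernel t x y; have M0 : 0 < M by exact: heat_kernel_gt0.
pose Q : R := (4 * pi * (t / 2)) `^ (- (d%:R / 2)).
have Q0 : 0 <= Q by exact: powR_ge0.
exists ((M + Q * Cg * C1) * kappa `^ (delta / 2)).
  by rewrite mulr_gt0 ?powR_gt0// ltr_pwDl// !mulr_ge0// ltW.
move=> s gamma st /andP[g0 g1]; set sigma := Num.min s (t - s).
have [s0 ts] := andP st.
have sigma0 : 0 < sigma by rewrite lt_min s0 subr_gt0.
pose r := Num.sqrt (sigma / kappa).
have r0 : 0 < r by rewrite sqrtr_gt0 divr_gt0.
have r2 : kappa * r ^+ 2 = sigma.
  by rewrite sqr_sqrtr ?divr_ge0 ?ltW//; field; rewrite gt_eqF.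
have r1 : r <= 1.
  rewrite -sqrtr1 ler_sqrt// ler_pdivrMr// mul1r.
  by rewrite ge_min /kappa (ltW (lt_le_trans ts _))// lerDr.
have rE : r `^ (- delta) = sigma `^ (- (delta / 2)) * kappa `^ (delta / 2).
  have sk0 : 0 <= sigma / kappa by rewrite ltW// divr_gt0.
  rewrite /r -powR12_sqrt// -powRrM mulrN [_^-1 * _]mulrC.
  rewrite powRM ?invr_ge0 ?(ltW sigma0) ?(ltW k0)//.
  by rewrite -(powR_inv1 (ltW k0)) -powRrM mulN1r opprK.
suff : (mu [set Y : path_space d t | (dist_to K (Y s) <= gamma)%R] <=
    ((M + Q * Cg * C1) * (r `^ (- delta) * gamma `^ delta))%:E)%E.
  by move=> /le_trans; apply; rewrite lee_fin rE le_eqVlt; apply/orP; left;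
    apply/eqP; ring.
have rg0 : 0 <= r `^ (- delta) * gamma `^ delta by rewrite mulr_ge0 ?powR_ge0.
have mK := measurable_neighborhood K gamma.
have [gr|rg] := leP gamma r; last first.
  apply: (@le_trans _ _ (mu setT)).
    apply: le_measure; rewrite ?inE//.
    exact: (measurable_cylinder1 s (ltW t0) mK).
  rewrite (bridge_mass t0 bmu) lee_fin -/M.
  apply: (@le_trans _ _ (M * (r `^ (- delta) * gamma `^ delta))).
    rewrite ler_peMr ?(ltW M0)// powRN mulrC ler_pdivlMr ?powR_gt0// mul1r.
    by apply: ge0_ler_powR; rewrite ?nnegrE ltW.
  by rewrite ler_wpM2r// lerDl !mulr_ge0// ltW.
rewrite (bridge_marginal st mK bmu).
(* [u] is the smaller of [s] and [t - s], and [w] the endpoint on that side. *)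
have main u (w : 'rV[R]_d) : 0 < u -> u = sigma ->
  (\int[lebesgue_rV R d]_(v in neighborhood K gamma)
     (Q%:E * (heat_kernel u w v)%:E) <=
   ((M + Q * Cg * C1) * (r `^ (- delta) * gamma `^ delta))%:E)%E.
  move=> u0 us.
  have hk0 (v : 'rV[R]_d) : (0 <= (heat_kernel u w v)%:E)%E.
    by rewrite lee_fin ltW// heat_kernel_gt0.
  rewrite ge0_integralZl_EFin//; last first.
    apply/measurable_EFinP/measurable_funTS; exact: measurable_heat_kernel.
  rewrite us -r2.
  apply: (@le_trans _ _ (Q%:E *
    (Cg * r `^ (- d%:R) * (C1 * r `^ alpha * gamma `^ delta))%:E)%E).
    apply: lee_wpmul2l; first by rewrite lee_fin.
    by apply: Hg => // v; exact: Kup.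
  rewrite -EFinM lee_fin [leLHS](_ : _ = Q * Cg * C1 * (r `^ (- delta) * gamma `^ delta)).
    by rewrite ler_wpM2r// lerDr ltW.
  have -> : r `^ (- delta) = r `^ alpha * r `^ (- d%:R).
    by rewrite /delta opprB powRD// (gt_eqF r0) implybT.
  ring.
have [sts|tss] := leP s (t - s).
- have ss : s = sigma by rewrite /sigma min_l.
  apply: le_trans (main s x s0 ss); apply: ge0_le_integral => //.
  + move=> v _; rewrite mule_ge0// lee_fin ltW// heat_kernel_gt0// subr_gt0//.
  + apply: emeasurable_funM; apply/measurable_EFinP/measurable_funTS.
      exact: measurable_heat_kernel.
    under eq_fun do rewrite heat_kernel_sym.
    exact: measurable_heat_kernel.
  + apply: emeasurable_funM => //; apply/measurable_EFinP/measurable_funTS.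
    exact: measurable_heat_kernel.
  + move=> v _; rewrite -!EFinM lee_fin mulrC ler_wpM2r//.
      by rewrite ltW// heat_kernel_gt0.
    by apply: heat_kernel_le; lra.
- have ss : t - s = sigma by rewrite /sigma min_r// ltW.
  have ts0 : 0 < t - s by rewrite subr_gt0.
  apply: le_trans (main (t - s) y ts0 ss); apply: ge0_le_integral => //.
  + move=> v _; rewrite mule_ge0// lee_fin ltW// heat_kernel_gt0//.
  + apply: emeasurable_funM; apply/measurable_EFinP/measurable_funTS.
      exact: measurable_heat_kernel.
    under eq_fun do rewrite heat_kernel_sym.
    exact: measurable_heat_kernel.
  + apply: emeasurable_funM => //; apply/measurable_EFinP/measurable_funTS.
    exact: measurable_heat_kernel.
  + move=> v _; rewrite -!EFinM lee_fin [heat_kernel (t - s) _ _]heat_kernel_sym.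
    rewrite ler_wpM2r//; first by rewrite ltW// heat_kernel_gt0.
    by apply: heat_kernel_le; lra.
Qed.
End bridge_bounds.

(** * Positivity of the Feynman-Kac kernel *)

Lemma measurable_expeRN d (T : measurableType d) (R : realType) (f : T -> \bar R) :
  measurable_fun setT f -> (forall x, 0 <= f x)%E ->
  measurable_fun setT (fun x => expeR (- f x)%E).
Proof.
move=> mf f0.
rewrite (_ : (fun x => _) = fun x =>
   if f x == +oo%E then 0%E else (expR (- fine (f x)))%:E); last first.
  by apply/funext => x; case: (f x) (f0 x) => //=.
apply: measurable_fun_ifT => //.
  apply: (measurable_fun_bool true).
  rewrite (_ : _ @^-1` _ = f @^-1` [set +oo%E]).
    exact: mf.
  by apply/seteqP; split => x /= /eqP.
apply/measurable_EFinP; apply: measurableT_comp => //.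
apply: measurableT_comp => //.
exact: measurableT_comp.
Qed.

Section feynman_kac_positivity.
Context (R : realType) (d : nat).
Implicit Types (x y z : 'rV[R]_d) (K : set 'rV[R]_d) (t s : R).

(** [min s (t - s) <= gamma] only within [gamma] of the endpoints: this is
    [integral_negpow_le] with exponents [a < 1]. *)
Lemma integral_endpoint_negpow_lty (t a : R) : 0 < t -> 0 < a < 1 ->
  (\int[lebesgue_measure]_(s in `[0%R, t]) negpow a (Num.min s (t - s))%R < +oo)%E.
Proof.
move=> t0 /andP[a0 a1].
have mm : measurable_fun `[0, t]%classic (fun s : R => Num.min s (t - s)%R).
  by apply: measurable_minr => //; apply: measurable_funB.
have et : @lebesgue_measure R `[0, t]%classic = t%:E.
  by rewrite lebesgue_measure_itv/= lte_fin t0 -EFinB subr0.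
have := @integral_negpow_le R _ _ (@lebesgue_measure R) `[0, t]%classic
  (fun s => Num.min s (t - s)) a 1 2 (measurable_itv _) mm _ a0 a1.
move=> /(_ _ _)/le_lt_trans; apply.
- by move=> s; rewrite /= in_itv/= le_min subr_ge0.
- move=> gamma /andP[g0 g1].
  have mg (u : R) : @lebesgue_measure R `[u, u + gamma]%classic = gamma%:E.
    by rewrite lebesgue_measure_itv/= lte_fin ltrDl g0 -EFinD addrAC subrr add0r.
  have S : `[0, t]%classic `&` [set s | Num.min s (t - s) <= gamma] `<=`
      `[0, 0 + gamma]%classic `|` `[t - gamma, t - gamma + gamma]%classic.
    move=> s []; rewrite /= !in_itv/= ge_min => /andP[s0 st] /orP[sg|sg].
      by left; lra.
    by right; lra.
  apply: (@le_trans _ _ (lebesgue_measure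
      (`[0%R, (0 + gamma)%R]%classic `|`
       `[(t - gamma)%R, (t - gamma + gamma)%R]%classic))).
    apply: le_measure => //; rewrite inE.
      rewrite (_ : [set s | _ <= gamma] =
          (fun s => Num.min s (t - s)) @^-1` `]-oo, gamma]%classic).
        exact: (mm (measurable_itv _) _ (measurable_itv _)).
      by apply/seteqP; split => s /=; rewrite in_itv.
    exact: measurableU.
  apply: le_trans (measureU2 _ _ _) _ => //.
  apply: (@le_trans _ _ (gamma%:E + gamma%:E)%E).
    by apply: leeD; rewrite le_eqVlt; apply/orP; left; apply/eqP; exact: mg.
  by rewrite powRr1 ?(ltW g0)// -EFinD lee_fin; lra.
- apply: lte_add_pinfty; last exact: ltry.
  apply: (@le_lt_trans _ _ t%:E); last exact: ltry.
  by rewrite le_eqVlt; apply/orP; left; apply/eqP; exact: et.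
Qed.

Lemma measurable_path_potential K (beta t : R) : 0 <= t ->
  measurable_fun setT (fun p : path_space d t * measurableTypeR R =>
    dist_potential K beta ((p.1 : path_space d t) p.2)).
Proof.
move=> t0; apply: (measurableT_comp (@measurable_negpow R beta)).
apply: measurable_path_eval => //; first exact: continuous_dist_to.
exact: measurable_dist_to.
Qed.

(** [H s] bounds the inner integral by the slicing lemma applied on path space
    to [Y |-> dist_to K (Y s)]. The bound [beta < d - alpha] makes the slices
    summable, and [d - alpha < 2] makes [H] integrable. *)
Lemma integral_bridge_potential_lty K (alpha C1 beta t : R) x y
    (mu : {finite_measure set (path_space d t) -> \bar R}) :
  d%:R - 2 < alpha -> alpha < d%:R -> 0 < C1 ->
  (forall x (r gamma : R), 0 < gamma -> gamma <= r -> r <= 1 ->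
     (lebesgue_rV R d (neighborhood K gamma `&` eball x r) <=
       (C1 * r `^ alpha * gamma `^ (d%:R - alpha))%:E)%E) ->
  0 < beta -> alpha + beta < d%:R ->
  0 < t -> is_brownian_bridge x y mu ->
  (\int[lebesgue_measure]_(s in `[0%R, t])
    \int[mu]_Y dist_potential K beta ((Y : path_space d t) s) < +oo)%E.
Proof.
move=> da ad C10 Kup beta0 abd t0 bmu.
have [C C0 HC] := bridge_neighborhood_le ad C10 Kup t0 bmu.
set delta := d%:R - alpha in HC.
have bdelta : beta < delta by rewrite ltrBrDl.
pose c := C * (2 `^ beta / (1 - 2 `^ (beta - delta))).
have c0 : 0 < c.
  by rewrite mulr_gt0// divr_gt0 ?powR_gt0// subr_gt0 powR2_subr_lt1.
pose H s : \bar R := ((heat_kernel t x y)%:E +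
  c%:E * negpow (delta / 2) (Num.min s (t - s)%R))%E.
have mn : measurable_fun `[0, t]%classic
    (fun s : R => negpow (delta / 2) (Num.min s (t - s)%R)).
  apply: (measurableT_comp (@measurable_negpow R _)).
  by apply: measurable_minr => //; apply: measurable_funB.
apply: (@le_lt_trans _ _ (\int[lebesgue_measure]_(s in `[0%R, t]) H s)%E).
  apply: ge0_le_integral => //.
  - by move=> s _; apply: integral_ge0 => Y _; exact: negpow_ge0.
  - apply: measurable_funTS.
    apply: (@measurable_fun_fubini_tonelli_G _ _ _ _ _ mu _
      (measurable_path_potential K beta (ltW t0))) => p.
    exact: negpow_ge0.
  - by apply: emeasurable_funD => //; apply: emeasurable_funM.
  - move=> s; rewrite /= in_itv/= => /andP[s0 st].
    (* At the endpoints [Y s] is deterministic, but there [H s] is infinite. *)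
    have [e|ne] := eqVneq (Num.min s (t - s)) 0.
      by rewrite /H e /negpow eqxx gt0_muley ?lte_fin// addey// leey.
    have m0 : 0 < Num.min s (t - s) by rewrite lt_def ne le_min s0 subr_ge0.
    have st' : 0 < s < t by move: m0; rewrite lt_min subr_gt0.
    have mf : measurable_fun [set: path_space d t] (fun Y => dist_to K (Y s)).
      move=> _ B mB; rewrite setTI.
      apply: (@measurable_cylinder1 _ _ t s (dist_to K @^-1` B) (ltW t0)).
      by rewrite -[X in measurable X]setTI; exact: measurable_dist_to.
    have := @integral_negpow_le R _ _ mu setT (fun Y => dist_to K (Y s)) beta delta
      (C * Num.min s (t - s) `^ (- (delta / 2))) measurableT mf _ beta0 bdelta.
    move=> /(_ (fun Y _ => dist_to_ge0 K (Y s)) _)/le_trans; apply.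
      by move=> gamma g01; rewrite setTI; exact: HC.
    rewrite (bridge_mass t0 bmu) /H /negpow (negbTE ne) -EFinM.
    by rewrite /c le_eqVlt; apply/orP; left; apply/eqP; congr (_ + _%:E)%E; ring.
rewrite ge0_integralD//; last 3 first.
- by move=> s _; rewrite lee_fin ltW// heat_kernel_gt0.
- by move=> s _; rewrite mule_ge0 ?negpow_ge0// lee_fin ltW.
- by apply: emeasurable_funM.
apply: lte_add_pinfty.
  rewrite integral_cst//= lebesgue_measure_itv/= lte_fin t0 -EFinB -EFinM.
  exact: ltry.
rewrite ge0_integralZl_EFin ?ltW//; last by move=> s _; exact: negpow_ge0.
apply: lte_mul_pinfty => //; first by rewrite lee_fin ltW.
by apply: integral_endpoint_negpow_lty => //; apply/andP; rewrite /delta; split; lra.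
Qed.

(** If the integral vanished, [Phi] would be infinite almost everywhere; but it
    is integrable, and the bridge measure has positive total mass. *)
Lemma feynman_kac_gt0 K (alpha C1 beta t : R) x y
    (mu : {finite_measure set (path_space d t) -> \bar R}) :
  d%:R - 2 < alpha -> alpha < d%:R -> 0 < C1 ->
  (forall x (r gamma : R), 0 < gamma -> gamma <= r -> r <= 1 ->
     (lebesgue_rV R d (neighborhood K gamma `&` eball x r) <=
       (C1 * r `^ alpha * gamma `^ (d%:R - alpha))%:E)%E) ->
  0 < beta -> alpha + beta < d%:R ->
  0 < t -> is_brownian_bridge x y mu ->
  (0 < \int[mu]_(Y in [set: path_space d t])
    expeR (- \int[lebesgue_measure]_(s in `[0%R, t]) dist_potential K beta (Y s)))%E.
Proof.
move=> da ad C10 Kup beta0 abd t0 bmu.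
have fin := integral_bridge_potential_lty da ad C10 Kup beta0 abd t0 bmu.
set Phi := fun Y : path_space d t =>
  (\int[lebesgue_measure]_(s in `[0%R, t]) dist_potential K beta (Y s))%E.
pose h (p : path_space d t * measurableTypeR R) : \bar R :=
  (dist_potential K beta ((p.1 : path_space d t) p.2) *
    (\1_(`[0, t]%classic : set R) p.2)%:E)%E.
have h0 p : (0 <= h p)%E by rewrite mule_ge0 ?negpow_ge0// lee_fin.
have mh : measurable_fun setT h.
  apply: emeasurable_funM; first exact: (measurable_path_potential K beta (ltW t0)).
  apply/measurable_EFinP; apply: (measurableT_comp _ measurable_snd).
  exact: measurable_indic.
have PhiE : Phi = fun Y => (\int[lebesgue_measure]_s h (Y, s))%E.
  by apply/funext => Y; rewrite /Phi integral_mkcond epatch_indic.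
have mPhi : measurable_fun setT Phi.
  rewrite PhiE.
  exact: (@measurable_fun_fubini_tonelli_F _ _ _ _ _ (@lebesgue_measure R) h mh h0).
have Phi0 Y : (0 <= Phi Y)%E.
  by apply: integral_ge0 => s _; exact: negpow_ge0.
have intPhi : mu.-integrable setT Phi.
  apply/integrableP; split => //.
  under eq_integral => Y _ do rewrite gee0_abs//.
  rewrite PhiE (fubini_tonelli h mh h0); apply: le_lt_trans fin.
  rewrite [leRHS]integral_mkcond le_eqVlt; apply/orP; left; apply/eqP.
  apply: eq_integral => s _; rewrite epatch_indic /h /= indicE.
  case: (_ \in _).
    by rewrite mule1; apply: eq_integral => Y _; rewrite mule1.
  by rewrite mule0 integral0_eq// => Y _; rewrite mule0.
have E0 Y : (0 <= expeR (- Phi Y))%E by exact: expeR_ge0.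
rewrite lt_def; apply/andP; split; last by apply: integral_ge0 => Y _; exact: E0.
apply/negP => /eqP int0.
have mE := measurable_expeRN mPhi Phi0.
have : ae_eq mu setT (fun Y => expeR (- Phi Y)%E) (cst 0%E).
  apply/(ae_eq_integral_abs mu measurableT mE).
  rewrite -[RHS]int0; apply: eq_integral => Y _; exact: gee0_abs.
move=> aeE; have aeF := integrable_ae measurableT intPhi.
have : mu.-negligible [set: path_space d t].
  have : (\forall Y \ae mu, False).
    move: aeE aeF; apply: filterS2 => Y /(_ I) e /(_ I) f.
    move/eqP: e; rewrite expeR_eq0; case: (Phi Y) f => //.
  by apply: negligibleS => Y _ /=; case.
move/(negligibleP mu measurableT) => mu0.
have [] := etrans (esym (bridge_mass t0 bmu)) mu0.
by apply/eqP; rewrite gt_eqF// heat_kernel_gt0.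
Qed.

End feynman_kac_positivity.

Section finite_mass.
Context d (T : measurableType d) (R : realType) (m : {measure set T -> \bar R}).

(** [m] itself, carrying the finite measure structure given by the proof. *)
Definition finite_mass (fm : fin_num_fun m) : set T -> \bar R := m.

Context (fm : fin_num_fun m).
HB.instance Definition _ := Measure.on (finite_mass fm).
HB.instance Definition _ := Measure_isFinite.Build _ _ _ (finite_mass fm) fm.
End finite_mass.

Theorem corollary4p2 (R : realType) (d : nat) (D : set 'rV[R]_d)
    (alpha C1 C2 beta : R)
    (mu : forall (t : R) (x y : 'rV[R]_d), {measure set (path_space d t) -> \bar R}) :
  (2 <= d)%N ->
  D !=set0 -> D != setT -> open D -> simply_connected D ->
  d%:R - 2 < alpha -> alpha < d%:R -> 0 < C1 -> 0 < C2 ->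
  (forall (x : 'rV[R]_d) (r gamma : R), 0 < gamma -> gamma <= r -> r <= 1 ->
     (lebesgue_rV R d (neighborhood (boundary D) gamma `&` eball x r) <=
       (C1 * r `^ alpha * gamma `^ (d%:R - alpha))%:E)%E) ->
  (forall (r gamma : R) (x : 'rV[R]_d), 0 < gamma -> gamma <= r -> r <= 1 ->
     neighborhood (boundary D) (r / 2) x ->
     ((C2 * r `^ alpha * gamma `^ (d%:R - alpha))%:E <=
       lebesgue_rV R d (neighborhood (boundary D) gamma `&` eball x r))%E) ->
  0 < beta ->
  (forall (t : R) (x y : 'rV[R]_d), 0 < t -> is_brownian_bridge x y (mu t x y)) ->
  (separates (feynman_kac_kernel mu (dist_potential (boundary D) beta)) D ->
     d%:R <= alpha + beta) /\
  (alpha + beta < d%:R ->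
     forall (t : R) (x y : 'rV[R]_d), 0 < t ->
       (0 < feynman_kac_kernel mu (dist_potential (boundary D) beta) t x y)%E).
Proof.
move=> _ [x Dx] DT _ _ da ad C10 _ Kup _ beta0 bmu.
have pos : alpha + beta < d%:R -> forall (t : R) (u v : 'rV[R]_d), 0 < t ->
    (0 < feynman_kac_kernel mu (dist_potential (boundary D) beta) t u v)%E.
  move=> abd t u v t0; rewrite /feynman_kac_kernel.
  have fmu : fin_num_fun (mu t u v).
    apply: lty_fin_num_fun.
    by rewrite (bridge_mass t0 (bmu t u v t0)) ltry.
  exact: (@feynman_kac_gt0 R d (boundary D) alpha C1 beta t u v
    (finite_mass fmu) da ad C10 Kup beta0 abd t0 (bmu t u v t0)).
split=> // sep; rewrite leNgt; apply/negP => abd.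
have [y Dy] : exists y, (~` D) y.
  by apply/existsNP => DA; move/eqP: DT; apply; apply/seteqP; split.
by have := pos abd 1 x y ltr01; rewrite (sep 1 x y ltr01 Dx Dy) ltxx.
Qed.
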